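(* Let $\mu$ be a Borel probability measure on $\mathcal{X}$ with $\operatorname{conv}(\operatorname{supp}(\mu))\subset V$, and set $U=\Pi\widetilde\Sigma^{-1}\Pi^\top$. Then $\widehat D_\mu$ is monotone and $\frac{M^2}{\lambda_{\min}(\widetilde\Sigma)}$-Lipschitz continuous on the Hilbert space $(V,\|\cdot\|_U)$. Moreover, $\log p_\mu$ is $\lambda_{\min}(\widetilde\Sigma)^{-1}$-weakly convex on $(V,\|\cdot\|)$.
   Context: $\mathcal{X}\subset\mathbb{R}^n$ is compact and $M>0$ is fixed with $\max_{\mathbf{x}\in\mathcal{X}}\|\mathbf{x}\|\le M$. $\Sigma\in\mathbb{R}^{n\times n}$ is symmetric positive semidefinite, $V=\operatorname{ran}(\Sigma)$, $r=\operatorname{rank}(\Sigma)$, $\Pi$ is an $n\times r$ matrix whose columns form an orthonormal basis of $V$, and $\widetilde\Sigma=\Pi^\top\Sigma\Pi$ (positive definite), with smallest eigenvalue $\lambda_{\min}(\widetilde\Sigma)$. For $\mathbf{z}\in V$, $$\varphi(\mathbf{v})=\exp\big(-\tfrac12\mathbf{v}^\top\Pi\widetilde\Sigma^{-1}\Pi^\top\mathbf{v}\big),\quad p_\mu(\mathbf{z})=\int_{\mathcal{X}}\varphi(\mathbf{z}-\mathbf{x})\,d\mu(\mathbf{x}),\quad \widehat D_\mu(\mathbf{z})=\frac{1}{p_\mu(\mathbf{z})}\int_{\mathcal{X}}\mathbf{x}\,\varphi(\mathbf{z}-\mathbf{x})\,d\mu(\mathbf{x})\in V.$$ On $V$, $\langle\mathbf{x},\mathbf{z}\rangle_U=\langle\mathbf{x},U\mathbf{z}\rangle$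 and $\|\mathbf{x}\|_U=\sqrt{\langle\mathbf{x},U\mathbf{x}\rangle}$. Monotone on $(V,\|\cdot\|_U)$ means $\langle\widehat D_\mu(\mathbf{u})-\widehat D_\mu(\mathbf{v}),\mathbf{u}-\mathbf{v}\rangle_U\ge0$ for all $\mathbf{u},\mathbf{v}\in V$. A function $f$ on $V$ is $\rho$-weakly convex on $(V,\|\cdot\|)$ if $f+\frac\rho2\|\cdot\|^2$ is convex. *)

(* Defs.v *)
From HB Require Import structures.
From mathcomp Require Import all_boot all_order all_algebra.
From mathcomp Require Import all_classical all_reals all_analysis.

Set Implicit Arguments.
Unset Strict Implicit.
Unset Printing Implicit Defensive.

Import Order.TTheory GRing.Theory Num.Theory.
Import numFieldNormedType.Exports.

Local Open Scope classical_set_scope.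
Local Open Scope ring_scope.

Definition dotv (R : realType) (n : nat) (x y : 'cV[R]_n) : R :=
  (x^T *m y) 0 0.

(* The canonical norm on 'cV[R]_n is the sup norm, hence this Euclidean one. *)
Definition enorm (R : realType) (n : nat) (x : 'cV[R]_n) : R :=
  Num.sqrt (dotv x x).

Definition dotU (R : realType) (n : nat) (U : 'M[R]_n) (x z : 'cV[R]_n) : R :=
  dotv x (U *m z).

Definition normU (R : realType) (n : nat) (U : 'M[R]_n) (x : 'cV[R]_n) : R :=
  Num.sqrt (dotU U x x).

Definition symmetric_psd (R : realType) (n : nat) (S : 'M[R]_n) : Prop :=
  S^T = S /\ forall x : 'cV[R]_n, 0 <= dotv x (S *m x).

Definition ran (R : realType) (m n : nat) (A : 'M[R]_(m, n)) : set 'cV[R]_m :=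
  range (fun x : 'cV[R]_n => A *m x).

(* The columns of P are orthonormal (Gram matrix) and their span is V. *)
Definition orthonormal_basis_cols (R : realType) (n r : nat)
    (P : 'M[R]_(n, r)) (V : set 'cV[R]_n) : Prop :=
  P^T *m P = 1%:M /\ ran P = V.

(* For a symmetric A of positive size the set of eigenvalues is finite and
   nonempty, so that the infimum is a minimum; for the empty matrix it is 0. *)
Definition lambda_min (R : realType) (n : nat) (A : 'M[R]_n) : R :=
  inf [set a : R | eigenvalue A a].

Notation borel_cV R n := (g_sigma_algebraType (@open 'cV[R]_n)).

Definition supp (R : realType) (n : nat) (mu : probability (borel_cV R n) R) :
    set 'cV[R]_n :=
  [set x | forall A : set 'cV[R]_n, open A -> A x -> (0 < mu A)%E].

Definition conv_hull (R : realType) (n : nat) (A : set 'cV[R]_n) :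
    set 'cV[R]_n :=
  smallest (@convex_set R 'cV[R]_n) A.

Section denoiser.
Context (R : realType) (n r : nat).
Variables (Sigma : 'M[R]_n) (Pi : 'M[R]_(n, r)).

Definition Sigma_tilde : 'M[R]_r := Pi^T *m Sigma *m Pi.

Definition phi (v : 'cV[R]_n) : R :=
  expR (- 2^-1 * (v^T *m Pi *m invmx Sigma_tilde *m Pi^T *m v) 0 0).

Variables (X : set 'cV[R]_n) (mu : probability (borel_cV R n) R).

Definition p_mu (z : 'cV[R]_n) : R := \int[mu]_(x in X) phi (z - x).

(* The vector-valued integral is taken coordinatewise. *)
Definition D_hat (z : 'cV[R]_n) : 'cV[R]_n :=
  (p_mu z)^-1 *: \col_i \int[mu]_(x in X) ((x : 'cV[R]_n) i 0 * phi (z - x)).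

End denoiser.

Definition monotone_on (R : realType) (n : nat) (V : set 'cV[R]_n)
    (U : 'M[R]_n) (f : 'cV[R]_n -> 'cV[R]_n) : Prop :=
  forall u v, V u -> V v -> 0 <= dotU U (f u - f v) (u - v).

Definition lipschitz_U_on (R : realType) (n : nat) (V : set 'cV[R]_n)
    (U : 'M[R]_n) (L : R) (f : 'cV[R]_n -> 'cV[R]_n) : Prop :=
  forall u v, V u -> V v -> normU U (f u - f v) <= L * normU U (u - v).

Definition weakly_convex_on (R : realType) (n : nat) (V : set 'cV[R]_n)
    (rho : R) (f : 'cV[R]_n -> R) : Prop :=
  convex_function V (fun z : 'cV[R]_n => f z + rho / 2 * enorm z ^+ 2).

(* Main.v *)
Require Import Defs.
From mathcomp Require Import all_boot all_order all_algebra.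
From mathcomp Require Import all_classical all_reals all_analysis.
From mathcomp Require Import ring lra.

(* Everything depends only on the positive semidefinite form <x, z>_U, which is
   bounded by |x|^2 / lambda_min.  Since
     phi (z - x) = e^(-<z,z>_U / 2) e^(<x,z>_U - <x,x>_U / 2),
   D_hat z is a weighted mean of x, and passing from z = v to z = u tilts the
   weight by e^(<x,u-v>_U), up to a constant factor:
   - tilting by e^a increases the mean of a, which gives monotonicity;
   - if |a| <= A and |b| <= B, tilting by e^a changes the mean of b by at most
     A B; with a = <x,u-v>_U and b = <x,d>_U for d = D_hat u - D_hat v, this
     gives the Lipschitz bound;
   - ln p_mu z + <z,z>_U / 2 is the logarithm of a Laplace transform, hence
     convex, and |z|^2 / lambda_min - <z,z>_U is positive semidefinite. *)

Set Implicit Arguments.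
Unset Strict Implicit.
Unset Printing Implicit Defensive.

Import Order.TTheory GRing.Theory Num.Theory.
Import numFieldNormedType.Exports.

Local Open Scope classical_set_scope.
Local Open Scope ring_scope.

(** The trapezoid rule overestimates the integral of the convex [expR] over [0, x]. Equivalently,
    tanh (x/2) <= x/2. *)
Lemma expR_le_trapezoid (R : realType) (x : R) :
  0 <= x -> 2 * (expR x - 1) <= x * (expR x + 1).
Proof.
move=> x0.
pose f (y : R) : R := (y - 2) * expR y + (y + 2).
have df (y : R) : is_derive y 1 f ((y - 1) * expR y + 1).
  apply: is_derive_eq.
  by rewrite /GRing.scale /= !(addr0, add0r, mulr1); ring.
have : f 0 <= f x.
  apply: (@ger0_derive1_ndecry R f 0) => //.
  - move=> y _; rewrite derive1E derive_val.
    have : 1 - y <= (expR y)^-1 by rewrite -expRN; exact: expR_ge1Dx.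
    by rewrite -[leRHS]mul1r ler_pdivlMr ?expR_gt0//; lra.
  - apply: continuous_subspaceT => y.
    by apply: differentiable_continuous; apply/derivable1_diffP.
rewrite /f expR0; lra.
Qed.

(** * Means under exponentially tilted weights *)

Section exponential_tilting.
Context d {T : measurableType d} {R : realType}.
Variables (mu : {measure set T -> \bar R}) (D : set T).
Hypothesis mD : measurable D.
Local Notation integrable f := (mu.-integrable D (EFin \o f)).

Lemma integrableZl_EFin k (f : T -> R) :
  integrable f -> integrable (fun x => k * f x).
Proof.
move=> fi; apply: (eq_integrable mD) (integrableZl mD k fi) => x _.
by rewrite /= EFinM.
Qed.

Lemma integrableD_EFin (f g : T -> R) :
  integrable f -> integrable g -> integrable (fun x => f x + g x).
Proof.
move=> fi gi; apply: (eq_integrable mD) (integrableD mD fi gi) => x _.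
by rewrite /= EFinD.
Qed.

Lemma Rintegral_lin (k l : R) (f g : T -> R) :
  integrable f -> integrable g ->
  \int[mu]_(x in D) (k * f x + l * g x) =
  k * \int[mu]_(x in D) f x + l * \int[mu]_(x in D) g x.
Proof.
move=> fi gi; rewrite RintegralD ?RintegralZl//; exact: integrableZl_EFin.
Qed.

(** Integrability is carried along with the identity, because additivity needs it at each induction
    step. *)
Lemma Rintegral_sum I (s : seq I) (f : I -> T -> R) :
  (forall i, integrable (f i)) ->
  integrable (fun x => \sum_(i <- s) f i x) /\
  \int[mu]_(x in D) (\sum_(i <- s) f i x) =
  \sum_(i <- s) \int[mu]_(x in D) f i x.
Proof.
move=> fi; elim: s => [|i s [IHi IHs]].
  rewrite big_nil; under [X in X = _]eq_Rintegral do rewrite big_nil.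
  rewrite Rintegral_cst// mul0r; split=> //.
  apply: (@eq_integrable _ _ _ mu D mD (cst 0%E) _ _ (integrable0 mu D)).
  by move=> x _; rewrite /= big_nil.
split.
  apply: (eq_integrable mD _ _ _ (integrableD_EFin (fi i) IHi)) => x _.
  by rewrite /= big_cons.
rewrite big_cons -IHs -RintegralD//.
by under eq_Rintegral do rewrite big_cons.
Qed.

Variables (a w : T -> R).
Hypothesis w0 : forall x, D x -> 0 <= w x.
Hypothesis wi : integrable w.
Hypothesis ei : integrable (fun x => expR (a x) * w x).
Hypothesis W0 : 0 < \int[mu]_(x in D) w x.
Hypothesis E0 : 0 < \int[mu]_(x in D) (expR (a x) * w x).

(* Pointwise, [(a - m) (e^a - e^m) >= 0] for the mean [m] of [a]. *)
Lemma tilted_mean_ge :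
  integrable (fun x => a x * w x) ->
  integrable (fun x => a x * (expR (a x) * w x)) ->
  (\int[mu]_(x in D) w x)^-1 * \int[mu]_(x in D) (a x * w x) <=
  (\int[mu]_(x in D) (expR (a x) * w x))^-1 *
    \int[mu]_(x in D) (a x * (expR (a x) * w x)).
Proof.
move=> awi aei.
set m := _ * _.
have mE : \int[mu]_(x in D) (a x * w x) = m * \int[mu]_(x in D) w x.
  by rewrite /m mulrAC mulVf ?mul1r// gt_eqF.
rewrite ler_pdivlMl// mulrC -subr_ge0.
have h1 := integrableZl_EFin (- m) ei.
have h2 := integrableZl_EFin (- m) wi.
(* Subtracting [expR m] times [(a x - m) * w x] is free: its integral vanishes by the choice of [m].
   The factors [1] give the integrand the shape of [Rintegral_lin]. *)
suff : 0 <= \int[mu]_(x in D) ((1 * (1 * (a x * (expR (a x) * w x))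
     + - m * (expR (a x) * w x)) + - expR m * (1 * (a x * w x) + - m * w x))).
  rewrite !Rintegral_lin//.
  - by rewrite mE; lra.
  - by apply: integrableD_EFin => //; exact: integrableZl_EFin.
  - by apply: integrableD_EFin => //; exact: integrableZl_EFin.
apply: Rintegral_ge0 => x Dx.
rewrite (_ : _ + _ = (a x - m) * (expR (a x) - expR m) * w x); last by ring.
apply: mulr_ge0; last exact: w0.
have [am|am] := leP (a x) m.
  by rewrite mulr_le0 ?subr_le0 ?ler_expR.
by rewrite mulr_ge0 ?subr_ge0 ?ler_expR// ltW.
Qed.

(* With [z] the mean of [e^a], [|e^a - z|] is a convex function of [e^a], hence
   below its chord over [[e^-A, e^A]]; integrating the chord leaves the bound [2 tanh (A/2) <= A]. *)
Lemma tilted_mean_lip_gt0 (b : T -> R) (A B : R) :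
  0 < A -> 0 <= B ->
  (forall x, D x -> `|a x| <= A) -> (forall x, D x -> `|b x| <= B) ->
  integrable (fun x => b x * w x) ->
  integrable (fun x => b x * (expR (a x) * w x)) ->
  (\int[mu]_(x in D) (expR (a x) * w x))^-1 *
    \int[mu]_(x in D) (b x * (expR (a x) * w x)) -
  (\int[mu]_(x in D) w x)^-1 * \int[mu]_(x in D) (b x * w x) <= A * B.
Proof.
move=> A0 B0 aA bB bwi bei.
set E := \int[mu]_(x in D) (expR (a x) * w x).
set W := \int[mu]_(x in D) w x.
pose p := expR (- A); pose q := expR A; pose z := E / W.
have pq1 : p * q = 1 by rewrite mulrC expRxMexpNx_1.
have q1 : 1 < q by rewrite expR_gt1.
have pq : 0 < q - p by rewrite subr_gt0 ltr_expR; lra.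
have eaP x : D x -> p <= expR (a x) <= q.
  by move=> /aA; rewrite ler_norml !ler_expR.
have pz : p <= z.
  rewrite ler_pdivlMr// -RintegralZl//; apply: le_Rintegral => //.
    exact: integrableZl_EFin.
  by move=> x Dx; apply: ler_wpM2r; [exact: w0|case/andP: (eaP _ Dx)].
have zq : z <= q.
  rewrite ler_pdivrMr// -RintegralZl//; apply: le_Rintegral => //.
    exact: integrableZl_EFin.
  by move=> x Dx; apply: ler_wpM2r; [exact: w0|case/andP: (eaP _ Dx)].
have EE : E = z * W by rewrite /z divfK// gt_eqF.
have z0 : 0 < z by rewrite divr_gt0.
rewrite -[X in X - _]mulrC -[X in _ - X]mulrC.
rewrite (_ : _ - _ = (\int[mu]_(x in D) (b x * (expR (a x) * w x))
   - z * \int[mu]_(x in D) (b x * w x)) / E); last first.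
  by rewrite EE; field; rewrite !gt_eqF.
rewrite ler_pdivrMr//.
set lhs := _ - _.
have : lhs * (q - p) <= B * ((z - p) * (q * W - E) + (q - z) * (E - p * W)).
  rewrite (_ : lhs * _ = (q - p) * \int[mu]_(x in D) (b x * (expR (a x) * w x))
    + - (z * (q - p)) * \int[mu]_(x in D) (b x * w x)); last first.
    by rewrite /lhs; ring.
  rewrite (_ : B * _ = (B * (q + p - z - z)) * E
      + (B * (z * q + z * p - q * p - q * p)) * W); last by ring.
  rewrite /E /W -!Rintegral_lin//; apply: le_Rintegral => //.
  - by apply: integrableD_EFin; exact: integrableZl_EFin.
  - by apply: integrableD_EFin; exact: integrableZl_EFin.
  move=> x Dx; have /andP[pe eq] := eaP _ Dx.
  have := w0 Dx; have := bB _ Dx; rewrite ler_norml => /andP[Bb bB'].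
  set y := expR (a x) in pe eq * => wx0.
  rewrite (_ : _ + _ = (b x * ((y - z) * (q - p))) * w x); last by ring.
  rewrite [leRHS](_ : _ = (B * ((z - p) * (q - y) + (q - z) * (y - p))) * w x);
    last by ring.
  apply: ler_wpM2r => //.
  have h1 : 0 <= (z - p) * (q - y) by rewrite mulr_ge0// subr_ge0.
  have h2 : 0 <= (q - z) * (y - p) by rewrite mulr_ge0// subr_ge0.
  (* A difference of two nonnegative terms whose sum is the chord; with [b x] between [- B] and [B],
     the product is at most [B] times that sum. *)
  have -> : (y - z) * (q - p) = (q - z) * (y - p) - (z - p) * (q - y) by ring.
  nra.
rewrite EE (_ : _ + _ = (z - p) * (q - z) * 2 * W); last by ring.
move=> h; rewrite -(ler_pM2r pq); apply: (le_trans h).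
rewrite [leRHS](_ : _ = B * W * (A * z * (q - p))); last by ring.
rewrite [leLHS](_ : _ = B * W * ((z - p) * (q - z) * 2)); last by ring.
apply: ler_wpM2l; first by rewrite mulr_ge0// ltW.
(* As [p * q = 1], the gap between the two sides is the square of [z - 1]. *)
have h1 : (z - p) * (q - z) <= z * (p + q - 2).
  rewrite -subr_ge0 (_ : _ - _ = (z - 1) ^+ 2 + (p * q - 1)); last by ring.
  by rewrite pq1 subrr addr0 sqr_ge0.
have h2 : 2 * (p + q - 2) <= A * (q - p).
  have q0 : 0 < q by rewrite expR_gt0.
  (* Multiplying by [q] and using [p * q = 1] turns the claim into [q - 1] times
     [expR_le_trapezoid]. *)
  rewrite -(ler_pM2r q0).
  rewrite [leLHS](_ : _ = 2 * ((p * q) + q ^+ 2 - 2 * q)); last by ring.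
  rewrite [leRHS](_ : _ = A * (q ^+ 2 - p * q)); last by ring.
  rewrite pq1 [leLHS](_ : _ = (q - 1) * (2 * (q - 1))); last by ring.
  rewrite [leRHS](_ : _ = (q - 1) * (A * (q + 1))); last by ring.
  by rewrite ler_wpM2l ?expR_le_trapezoid ?subr_ge0; rewrite // ltW.
have := ler_wpM2l (ltW z0) h2; nra.
Qed.

(** For [A = 0] the interval of the chord degenerates, so this case is reached as a limit: enlarging
    [A] by [e / (B + 1)] raises the bound by at most [e]. *)
Lemma tilted_mean_lip (b : T -> R) (A B : R) :
  0 <= A -> 0 <= B ->
  (forall x, D x -> `|a x| <= A) -> (forall x, D x -> `|b x| <= B) ->
  integrable (fun x => b x * w x) ->
  integrable (fun x => b x * (expR (a x) * w x)) ->
  (\int[mu]_(x in D) (expR (a x) * w x))^-1 *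
    \int[mu]_(x in D) (b x * (expR (a x) * w x)) -
  (\int[mu]_(x in D) w x)^-1 * \int[mu]_(x in D) (b x * w x) <= A * B.
Proof.
move=> A0 B0 aA bB bwi bei; apply/ler_addgt0Pr => e e0.
have B1 : 0 < B + 1 by lra.
have e1 : 0 < e / (B + 1) by rewrite divr_gt0.
apply: le_trans (@tilted_mean_lip_gt0 b (A + e / (B + 1)) B _ _ _ _ _ _) _ => //.
- lra.
- by move=> x Dx; apply: (le_trans (aA _ Dx)); rewrite lerDl ltW.
rewrite mulrDl lerD2l -mulrA ger_pMr// mulrC ler_pdivrMr//; lra.
Qed.

End exponential_tilting.

(* Hoelder's inequality for [e^f] and [e^g], obtained by integrating the
   convexity inequality of the exponential for the normalised exponents. *)
Lemma ln_Rintegral_expR_convex d (T : measurableType d) (R : realType)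
    (mu : {measure set T -> \bar R}) (D : set T) (f g : T -> R) (t : {i01 R}) :
  measurable D ->
  mu.-integrable D (EFin \o (fun x => expR (f x))) ->
  mu.-integrable D (EFin \o (fun x => expR (g x))) ->
  mu.-integrable D
    (EFin \o (fun x => expR (t%:num * f x + (1 - t%:num) * g x))) ->
  0 < \int[mu]_(x in D) expR (f x) -> 0 < \int[mu]_(x in D) expR (g x) ->
  0 < \int[mu]_(x in D) expR (t%:num * f x + (1 - t%:num) * g x) ->
  ln (\int[mu]_(x in D) expR (t%:num * f x + (1 - t%:num) * g x)) <=
  t%:num * ln (\int[mu]_(x in D) expR (f x)) +
  (1 - t%:num) * ln (\int[mu]_(x in D) expR (g x)).
Proof.
move=> mD fi gi hi f0 g0 h0.
set k := t%:num in hi h0 *; set F := \int[mu]_(x in D) expR (f x) in f0 *.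
set G := \int[mu]_(x in D) expR (g x) in g0 *.
(* [u] and [v] stand for the integrals [F] and [G]; dividing by them makes both exponentials
   integrate to 1. *)
have expR_conv (u v r s : R) : 0 < u -> 0 < v ->
    expR (- (k * ln u + (1 - k) * ln v)) * expR (k * r + (1 - k) * s) <=
    k * u^-1 * expR r + (1 - k) * v^-1 * expR s.
  move=> u0 v0; have : expR (k * (r - ln u) + (1 - k) * (s - ln v)) <=
      k * expR (r - ln u) + (1 - k) * expR (s - ln v) := convex_expR t _ _.
  rewrite -expRD !expRB !lnK// ![_ * _^-1 * _]mulrAC -!mulrA.
  apply: le_trans; rewrite ler_expR le_eqVlt; apply/orP; left.
  by apply/eqP; ring.
rewrite -ler_expR lnK; last exact: h0.
rewrite -[leRHS]mulr1 -ler_pdivrMl ?expR_gt0// -expRN -RintegralZl//.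
(* The bound 1 is itself the integral of the right-hand side of [expR_conv]. *)
rewrite [leRHS](_ : _ = k * F^-1 * F + (1 - k) * G^-1 * G); last first.
  by rewrite !mulfVK ?gt_eqF// addrC subrK.
rewrite -Rintegral_lin//; apply: le_Rintegral => //.
- exact: integrableZl_EFin.
- by apply: integrableD_EFin => //; exact: integrableZl_EFin.
by move=> x Dx; exact: expR_conv.
Qed.

(** * Semidefinite bilinear forms *)

Section bilinear_form.
Context (R : realType) (n : nat).
Implicit Types (U : 'M[R]_n) (x y z : 'cV[R]_n) (k : R).

Lemma dotvE x z : dotv x z = \sum_i x i 0 * z i 0.
Proof. by rewrite /dotv mxE; apply: eq_bigr => i _; rewrite mxE. Qed.

Lemma dotU1 x z : dotU 1%:M x z = dotv x z.
Proof. by rewrite /dotU mul1mx. Qed.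

Lemma dotUDl U x y z : dotU U (x + y) z = dotU U x z + dotU U y z.
Proof. by rewrite /dotU /dotv linearD mulmxDl mxE. Qed.

Lemma dotUZl U k x z : dotU U (k *: x) z = k * dotU U x z.
Proof. by rewrite /dotU /dotv linearZ -scalemxAl mxE. Qed.

Lemma dotUDr U x y z : dotU U z (x + y) = dotU U z x + dotU U z y.
Proof. by rewrite /dotU /dotv !mulmxDr mxE. Qed.

Lemma dotUZr U k x z : dotU U z (k *: x) = k * dotU U z x.
Proof. by rewrite /dotU /dotv -!scalemxAr mxE. Qed.

Lemma dotUNl U x z : dotU U (- x) z = - dotU U x z.
Proof. by rewrite -scaleN1r dotUZl mulN1r. Qed.

Lemma dotUBl U x y z : dotU U (x - y) z = dotU U x z - dotU U y z.
Proof. by rewrite dotUDl dotUNl. Qed.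

Lemma dotUNr U x z : dotU U z (- x) = - dotU U z x.
Proof. by rewrite -scaleN1r dotUZr mulN1r. Qed.

Lemma dotUC U x z : U^T = U -> dotU U x z = dotU U z x.
Proof.
have tr (A : 'M[R]_1) : A 0 0 = A^T 0 0 by rewrite mxE.
by move=> sU; rewrite /dotU /dotv tr !trmx_mul trmxK sU mulmxA.
Qed.

Lemma dotvv_ge0 x : 0 <= dotv x x.
Proof. by rewrite dotvE sumr_ge0// => i _; rewrite -expr2 sqr_ge0. Qed.

Lemma dotvv_eq0 x : (dotv x x == 0) = (x == 0).
Proof.
apply/eqP/eqP => [|->]; last by rewrite dotvE big1// => i _; rewrite mxE mul0r.
rewrite dotvE => /eqP; rewrite psumr_eq0 => [/allP h|i _]; last first.
  by rewrite -expr2 sqr_ge0.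
apply/colP => i; rewrite mxE; apply/eqP.
by have := h i (mem_index_enum _); rewrite mulf_eq0 orbb.
Qed.

(** Coordinatewise hypotheses over any space [T] serve both the columns integrated over and the
    transposed rows of the unit sphere. *)
Lemma continuous_dotU (T : topologicalType) U (f g : T -> 'cV[R]_n) :
  (forall i, continuous (fun t => f t i 0)) ->
  (forall i, continuous (fun t => g t i 0)) ->
  continuous (fun t => dotU U (f t) (g t)).
Proof.
move=> cf cg t.
have csum (h : 'I_n -> T -> R) : (forall i, continuous (h i)) ->
    continuous (fun t => \sum_i h i t).
  by move=> ch s; apply: cvg_big => [|i _]; [exact: add_continuous|exact: ch].
have -> : (fun s => dotU U (f s) (g s)) =
    (fun s => \sum_i f s i 0 * \sum_j U i j * g s j 0).
  by apply/funext => s; rewrite /dotU dotvE; apply: eq_bigr => i _; rewrite mxE.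
apply: (csum _) => i s; apply: continuousM; first exact: cf.
by apply: csum => j s'; apply: continuousM; [exact: cst_continuous|exact: cg].
Qed.

Lemma psd1 : symmetric_psd (1%:M : 'M[R]_n).
Proof. by split=> [|x]; rewrite ?trmx1// -/(dotU _ x x) dotU1 dotvv_ge0. Qed.

Section semidefinite.
Variable U : 'M[R]_n.
Hypothesis psdU : symmetric_psd U.

Lemma dotU_expand k x y : dotU U (x + k *: y) (x + k *: y) =
  dotU U x x + k * 2 * dotU U x y + k ^+ 2 * dotU U y y.
Proof.
rewrite !(dotUDl, dotUDr, dotUZl, dotUZr) (dotUC y x psdU.1); ring.
Qed.

Lemma dotU_subr x y : dotU U (x - y) (x - y) =
  dotU U x x - 2 * dotU U y x + dotU U y y.
Proof.
by rewrite -[- y]scaleN1r dotU_expand (dotUC x y psdU.1); ring.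
Qed.

Lemma dotU_cauchy_schwarz x y : dotU U x y ^+ 2 <= dotU U x x * dotU U y y.
Proof.
have h s t : 0 <= s ^+ 2 * dotU U x x + 2 * s * t * dotU U x y
    + t ^+ 2 * dotU U y y.
  have := psdU.2 (s *: x + t *: y); rewrite -/(dotU U _ _) dotU_expand.
  by rewrite !(dotUZl, dotUZr); lra.
have x0 : 0 <= dotU U x x := psdU.2 x.
have := psdU.2 y; rewrite -/(dotU U y y) le_eqVlt => /predU1P[y0|y0].
  (* When [dotU U y y = 0], this choice yields a nonpositive multiple of the square of [dotU U x y],
     which must therefore vanish. *)
  have := h (dotU U x y) (- (dotU U x x + 1)); rewrite -y0 !mulr0 addr0.
  set A := dotU U x x in x0 *; set B := dotU U x y.
  rewrite (_ : _ + _ = - (B ^+ 2 * (A + 2))); last by ring.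
  by rewrite oppr_ge0 pmulr_lle0//; lra.
have := h (dotU U y y) (- dotU U x y).
rewrite (_ : _ + _ = dotU U y y *
  (dotU U x x * dotU U y y - dotU U x y ^+ 2)); last by ring.
by rewrite pmulr_rge0// subr_ge0.
Qed.

Lemma normU_cauchy_schwarz x y : `|dotU U x y| <= normU U x * normU U y.
Proof.
rewrite /normU -sqrtrM; last exact: psdU.2.
by rewrite -sqrtr_sqr ler_wsqrtr// dotU_cauchy_schwarz.
Qed.

Lemma sqr_normU x : normU U x ^+ 2 = dotU U x x.
Proof. by rewrite sqr_sqrtr//; exact: psdU.2. Qed.

(** Cauchy-Schwarz for [U *m x] and [x]: their [U]-product is the squared Euclidean norm of
    [U *m x]. *)
Lemma psd_kernel x : dotU U x x = 0 -> U *m x = 0.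
Proof.
move=> x0; apply/eqP; rewrite -dotvv_eq0; apply/eqP.
have := dotU_cauchy_schwarz (U *m x) x.
rewrite x0 mulr0 exprn_even_le0//=.
by rewrite /dotU => /eqP.
Qed.

(** The gap is [k * (1 - k)] times the form at [x - y]. *)
Lemma dotU_convex k x y : 0 <= k -> k <= 1 ->
  dotU U (k *: x + (1 - k) *: y) (k *: x + (1 - k) *: y) <=
  k * dotU U x x + (1 - k) * dotU U y y.
Proof.
move=> k0 k1; rewrite -subr_ge0.
have : 0 <= k * (1 - k) * dotU U (x + (-1) *: y) (x + (-1) *: y).
  by rewrite mulr_ge0 ?(psdU.2)// mulr_ge0// subr_ge0.
rewrite !dotU_expand !(dotUZl, dotUZr); lra.
Qed.

End semidefinite.
End bilinear_form.

(** * The smallest eigenvalue and the inverse form *)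

Section smallest_eigenvalue.
Context (R : realType) (n : nat).
Variable S : 'M[R]_n.
Hypotheses (symS : S^T = S) (posS : forall x, x != 0 -> 0 < dotU S x x).

Lemma posdef_unitmx : S \in unitmx.
Proof.
rewrite -row_free_unit; apply: inj_row_free => v vS.
apply/eqP/negPn/negP => v0.
have /posS : v^T != 0 by rewrite trmx_eq0.
by rewrite /dotU /dotv trmxK mulmxA vS mul0mx mxE ltxx.
Qed.

(** The inverse form at [x] is the form of [S] at [invmx S *m x]. *)
Lemma invmx_psd : symmetric_psd (invmx S).
Proof.
split=> [|x]; first by rewrite trmx_inv symS.
have [->|x0] := eqVneq x 0; first by rewrite /dotv mulmx0 mulmx0 mxE.
have : 0 < dotU S (invmx S *m x) (invmx S *m x).
  apply: posS; apply: contraNneq x0 => h.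
  by rewrite -[x]mul1mx -(mulmxV posdef_unitmx) -mulmxA h mulmx0.
rewrite /dotU !mulmxA mulmxV ?posdef_unitmx// mul1mx => /ltW.
by rewrite -[dotv _ x]dotU1 dotUC ?trmx1// dotU1.
Qed.

Lemma eigenvalue_posdef_gt0 a : eigenvalue S a -> 0 < a.
Proof.
move=> /eigenvalueP[v vS v0].
have vv : 0 < dotv v^T v^T.
  by rewrite lt_neqAle dotvv_ge0 eq_sym dotvv_eq0 trmx_eq0 v0.
have /posS : v^T != 0 by rewrite trmx_eq0.
rewrite /dotU -symS -trmx_mul vS linearZ /= -[dotv _ _]dotU1 dotUZr dotU1.
by rewrite pmulr_lgt0.
Qed.

(** Strict positivity fails for the empty matrix, which has no eigenvalue and hence infimum 0. *)
Lemma lambda_min_ge0 : 0 <= lambda_min S.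
Proof.
rewrite /lambda_min; set A := [set a | _].
have [->|/set0P A0] := eqVneq A set0; first by rewrite inf0.
by apply: lb_le_inf => // a /eigenvalue_posdef_gt0/ltW.
Qed.

(** Row vectors fit both [bounded_closed_compact] and the left eigenvectors of [eigenvalue]. *)
Let unit_sphere : set 'rV[R]_n := [set v | dotv v^T v^T = 1].

Lemma compact_unit_sphere : compact unit_sphere.
Proof.
apply: bounded_closed_compact.
- exists 1; split => // b b1 v v1.
  rewrite /= [leLHS]/Num.norm /= mx_normrE.
  apply: bigmax_le => [|[i j] _]; first lra.
  have : `|v i j| ^+ 2 <= 1.
    rewrite -[1]v1 dotvE (bigD1 j)//= !mxE (ord1 i) -expr2.
    rewrite real_normK ?num_real//.
    by rewrite lerDl sumr_ge0// => k _; rewrite !mxE -expr2 sqr_ge0.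
  by rewrite expr_le1// => /le_trans; apply; exact: ltW.
- rewrite /unit_sphere -[X in closed X]/((fun v => dotv v^T v^T) @^-1` [set 1]).
  apply: preimage_closed; last exact: closed_eq.
  under eq_fun do rewrite -dotU1.
  move=> v _; apply: continuous_dotU => i t.
    under eq_fun do rewrite mxE; exact: coord_continuous.
  under eq_fun do rewrite mxE; exact: coord_continuous.
Qed.

(* The maximum [K] of the form [S^-1] on the unit sphere is attained, at a
   vector in the kernel of [K - S^-1]; hence [1 / K] is an eigenvalue of [S]. *)
Lemma dotU_invmx_le x :
  dotU (invmx S) x x <= (lambda_min S)^-1 * dotv x x.
Proof.
set Q := invmx S.
(* The zero vector is set apart, since a nonzero [x] is what shows the sphere to be nonempty. *)
have [x0|x0] := eqVneq x 0.
  by rewrite x0 /dotU mulmx0 /dotv mulmx0 !mxE mulr0.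
have dot_gt0 y : y != 0 -> 0 < dotv y y.
  by move=> y0; rewrite lt_neqAle dotvv_ge0 eq_sym dotvv_eq0 y0.
pose nrm (y : 'cV[R]_n) := (Num.sqrt (dotv y y))^-1 *: y.
have nrm1 y : y != 0 -> dotv (nrm y) (nrm y) = 1.
  move=> /dot_gt0 y0; rewrite -dotU1 dotUZl dotUZr dotU1 mulrA -expr2 exprVn.
  by rewrite sqr_sqrtr ?mulVf// ?gt_eqF// ltW.
have ne : unit_sphere !=set0.
  by exists (nrm x)^T; rewrite /unit_sphere /= trmxK nrm1.
have [|c] := @compact_EVT_max _ R (fun v : 'rV[R]_n => dotU Q v^T v^T) _ ne
    compact_unit_sphere.
  apply: continuous_subspaceT; apply: continuous_dotU => i t.
    under eq_fun do rewrite mxE; exact: coord_continuous.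
  under eq_fun do rewrite mxE; exact: coord_continuous.
rewrite inE /unit_sphere /= => c1 cmax.
set K := dotU Q c^T c^T in cmax.
(* By homogeneity, the maximum on the sphere bounds the form everywhere. *)
have bdK y : dotU Q y y <= K * dotv y y.
  have [->|y0] := eqVneq y 0.
    by rewrite /dotU mulmx0 /dotv mulmx0 !mxE mulr0.
  have := cmax (nrm y)^T; rewrite inE /= trmxK => /(_ (nrm1 _ y0)).
  rewrite dotUZl dotUZr mulrA -expr2 exprVn sqr_sqrtr ?dotvv_ge0//.
  by rewrite ler_pdivrMl ?dot_gt0// mulrC.
have formE y z : dotU (K%:M - Q) y z = K * dotv y z - dotU Q y z.
  rewrite /dotU mulmxBl mul_scalar_mx /dotv mulmxBr -scalemxAr.
  by rewrite mxE [in X in _ + X]mxE mxE.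
have psdK : symmetric_psd (K%:M - Q).
  split; first by rewrite linearB /= tr_scalar_mx invmx_psd.1.
  by move=> y; rewrite -/(dotU _ y y) formE subr_ge0.
have Qc : Q *m c^T = K *: c^T.
  have := @psd_kernel _ _ _ psdK c^T.
  rewrite formE c1 mulr1 subrr => /(_ erefl).
  by rewrite mulmxBl mul_scalar_mx => /eqP; rewrite subr_eq0 => /eqP ->.
have c0 : c != 0.
  by apply/eqP => c0; move: c1; rewrite c0 trmx0 /dotv mulmx0 mxE => /eqP;
    rewrite eq_sym oner_eq0.
have Sc : K *: (S *m c^T) = c^T.
  by rewrite scalemxAr -Qc mulmxA mulmxV ?posdef_unitmx// mul1mx.
have K0 : K != 0.
  by apply: contraNneq c0 => K0; rewrite -trmx_eq0 -Sc K0 scale0r.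
have evK : eigenvalue S K^-1.
  apply/eigenvalueP; exists c => //; apply: trmx_inj.
  by rewrite trmx_mul symS linearZ /= -[in RHS]Sc scalerA mulVf// scale1r.
have Kgt0 : 0 < K by rewrite -invr_gt0; exact: eigenvalue_posdef_gt0 evK.
suff -> : lambda_min S = K^-1 by rewrite invrK.
apply/eqP; rewrite eq_le; apply/andP; split.
  by apply: ge_inf => //; exists 0 => a /= /eigenvalue_posdef_gt0/ltW.
apply: lb_le_inf; first by exists K^-1.
move=> a /= ea; have a0 := eigenvalue_posdef_gt0 ea.
(* An eigenvector of [S] for [a] is one of [Q] for [a^-1], so [bdK] gives [1 <= a * K]. *)
case/eigenvalueP: ea => v vS v0.
have Sv : S *m v^T = a *: v^T by rewrite -symS -trmx_mul vS linearZ.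
have vE : v^T = a *: (Q *m v^T).
  by rewrite scalemxAr -Sv mulmxA mulVmx ?posdef_unitmx// mul1mx.
have vv : 0 < dotv v^T v^T by apply: dot_gt0; rewrite trmx_eq0.
have : dotv v^T v^T = a * dotU Q v^T v^T.
  by rewrite {2}vE -dotU1 dotUZr dotU1.
move=> vvE; rewrite -[leLHS]mul1r ler_pdivrMr// -(ler_pM2r vv) mul1r.
rewrite {1}vvE -mulrA.
by rewrite ler_pM2l.
Qed.

End smallest_eigenvalue.

(** * Integrals of continuous functions over a compact set *)

Section borel_integration.
Context (R : realType) (n : nat).
Variables (X : set 'cV[R]_n) (mu : probability (borel_cV R n) R).
Hypothesis hX : compact X.

Lemma compact_measurable_cV : measurable (X : set (borel_cV R n)).
Proof.
rewrite -[X]setCK; apply: measurableC; apply: sub_sigma_algebra.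
by apply: closed_openC; apply: compact_closed hX; exact: norm_hausdorff.
Qed.

Lemma continuous_measurable_cV (f : 'cV[R]_n -> R) :
  continuous f -> measurable_fun setT (f : borel_cV R n -> R).
Proof.
move=> /continuousP cf.
apply: (measurability _ (measurable_realfun.RGenOpens.measurableE R)).
move=> _ [_ [a [b ->] <-]]; rewrite setTI; apply: sub_sigma_algebra.
exact/cf/interval_open.
Qed.

(** [f] is bounded on the compact [X] and [mu] is finite. For the denoiser, this reduces
    integrability to continuity. *)
Lemma continuous_integrable_cV (f : 'cV[R]_n -> R) :
  continuous f -> mu.-integrable X (EFin \o (f : borel_cV R n -> R)).
Proof.
move=> cf; apply: measurable_bounded_integrable.
- exact: compact_measurable_cV.
- rewrite (le_lt_trans (probability_le1 _ _)) ?ltry//.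
  exact: compact_measurable_cV.
- by apply: measurable_funTS; exact: continuous_measurable_cV.
- have [M [Mr hM]] := compact_bounded (continuous_compact
    (continuous_subspaceT cf) hX).
  by exists M; split=> // y My x Xx; apply: (hM y My); exists x.
Qed.

(** [f] attains a positive minimum on [X], which has mass 1. The normalising integrals are thus
    positive. *)
Lemma continuous_Rintegral_gt0 (f : 'cV[R]_n -> R) :
  mu X = 1%E -> continuous f -> (forall x, 0 < f x) ->
  0 < \int[mu]_(x in X) f x.
Proof.
move=> mu1 cf f0.
have X0 : X !=set0.
  by apply/set0P/eqP => X0; move: mu1; rewrite X0 measure0 => /eqP;
    rewrite eq_sym onee_eq0.
have [c Xc cmin] := compact_EVT_min X0 hX (continuous_subspaceT cf).
apply: (lt_le_trans (f0 c)).
have mX := compact_measurable_cV.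
rewrite -[f c]mulr1 (_ : 1 = fine (mu X)); last by rewrite mu1.
rewrite -Rintegral_cst//; apply: le_Rintegral => //.
- exact/(@continuous_integrable_cV (cst (f c)))/cst_continuous.
- exact: continuous_integrable_cV.
- by move=> x Xx; apply: cmin; rewrite inE.
Qed.

End borel_integration.

(** The arithmetic of weak convexity: [p], [l], [d], [e] stand for ln p_mu, the log-Laplace
    transform, the [U]-form and the squared Euclidean norm at two points and at their
    combination. *)
Lemma le_conv_sub_half (R : realFieldType)
    (k rho px py pz ex ey ez lx ly lz dx dy dz : R) :
  px = - 2^-1 * dx + lx -> py = - 2^-1 * dy + ly -> pz = - 2^-1 * dz + lz ->
  lz <= k * lx + (1 - k) * ly ->
  rho * ez - dz <= k * (rho * ex - dx) + (1 - k) * (rho * ey - dy) ->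
  pz + rho / 2 * ez <= k * (px + rho / 2 * ex) + (1 - k) * (py + rho / 2 * ey).
Proof.
by move=> -> -> -> hl hd; lra.
Qed.

(** * Properties of the denoiser for a semidefinite [U] *)

Section denoiser_properties.
Context (R : realType) (n r : nat).
Variables (Sigma : 'M[R]_n) (Pi : 'M[R]_(n, r)).
Variables (X : set 'cV[R]_n) (mu : probability (borel_cV R n) R).
Let U := Pi *m invmx (Sigma_tilde Sigma Pi) *m Pi^T.
Hypotheses (hX : compact X) (muX : mu X = 1%E) (psdU : symmetric_psd U).

Let mX : measurable (X : set (borel_cV R n)) := compact_measurable_cV hX.

Local Notation phi := (phi Sigma Pi).
Local Notation p := (p_mu Sigma Pi X mu).
Local Notation D := (D_hat Sigma Pi X mu).

Lemma phiE v : phi v = expR (- 2^-1 * dotU U v v).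
Proof. by rewrite /Defs.phi /dotU /dotv /U !mulmxA. Qed.

Lemma phi_subr z x : phi (z - x) =
  expR (- 2^-1 * dotU U z z) * expR (dotU U x z - 2^-1 * dotU U x x).
Proof. by rewrite phiE (dotU_subr psdU) -expRD; congr expR; field. Qed.

(** The first factor does not depend on [x], so it cancels between the numerator and the normaliser
    of a weighted mean. *)
Lemma phi_tilt u v x : phi (u - x) =
  expR (2^-1 * dotU U v v - 2^-1 * dotU U u u) *
  (expR (dotU U x (u - v)) * phi (v - x)).
Proof.
rewrite !phi_subr -!expRD; congr expR; rewrite dotUDr dotUNr; ring.
Qed.

Lemma continuous_linear_form d : continuous (fun x : 'cV[R]_n => dotU U x d).
Proof.
by apply: continuous_dotU => i; [exact: coord_continuous|exact: cst_continuous].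
Qed.

Lemma continuous_phi z : continuous (fun x : 'cV[R]_n => phi (z - x)).
Proof.
under eq_fun do rewrite phiE.
move=> x; apply: continuous_comp; last exact: continuous_expR.
apply: continuousM; first exact: cst_continuous.
have c i : continuous (fun x : 'cV[R]_n => (z - x) i 0).
  move=> y; under eq_fun do rewrite !mxE.
  by apply: continuousB; [exact: cst_continuous|exact: coord_continuous].
exact: continuous_dotU.
Qed.

Lemma continuous_tilt a v :
  continuous (fun x : 'cV[R]_n => expR (dotU U x a) * phi (v - x)).
Proof.
move=> x; apply: (@continuousM _ _ (fun x => expR (dotU U x a))
  (fun x => phi (v - x))); last exact: continuous_phi.
apply: continuous_comp; last exact: continuous_expR.
exact: continuous_linear_form.
Qed.

Lemma continuous_linear_formM d (f : 'cV[R]_n -> R) :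
  continuous f -> continuous (fun x : 'cV[R]_n => dotU U x d * f x).
Proof.
move=> cf x; apply: (@continuousM _ _ (fun x => dotU U x d) f); last exact: cf.
exact: continuous_linear_form.
Qed.

Lemma phi_gt0 v : 0 < phi v. Proof. exact: expR_gt0. Qed.

(** The pairing is a finite combination of coordinates, with coefficients [(U *m d) i 0], so it
    passes under the coordinatewise integral. *)
Lemma dotU_D_hat z d : dotU U (D z) d =
  (p z)^-1 * \int[mu]_(x in X) (dotU U x d * phi (z - x)).
Proof.
rewrite dotUZl; congr (_ * _).
have dE x : dotU U x d = \sum_i (U *m d) i 0 * x i 0.
  by rewrite /dotU dotvE; apply: eq_bigr => i _; rewrite mulrC.
have int i : mu.-integrable X
    (EFin \o (fun x : borel_cV R n => (x : 'cV[R]_n) i 0 * phi (z - x))).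
  apply: (@continuous_integrable_cV _ _ _ _ hX (fun x => x i 0 * phi (z - x))).
  move=> x; apply: (@continuousM _ _ (fun x : 'cV[R]_n => x i 0)
    (fun x => phi (z - x))); [exact: coord_continuous|exact: continuous_phi].
rewrite dE; under eq_bigr do rewrite [X in _ * X]mxE -RintegralZl//.
rewrite -(Rintegral_sum mX _ _).2; last first.
  by move=> i; exact: integrableZl_EFin.
apply: eq_Rintegral => x _; rewrite dE mulr_suml.
by apply: eq_bigr => i _; rewrite mulrA.
Qed.

Lemma p_mu_tilt u v : p u = expR (2^-1 * dotU U v v - 2^-1 * dotU U u u) *
  \int[mu]_(x in X) (expR (dotU U x (u - v)) * phi (v - x)).
Proof.
rewrite -RintegralZl//; last exact/continuous_integrable_cV/continuous_tilt.
by apply: eq_Rintegral => x _; rewrite (phi_tilt u v).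
Qed.

Lemma dotU_D_hat_tilt u v d : dotU U (D u) d =
  (\int[mu]_(x in X) (expR (dotU U x (u - v)) * phi (v - x)))^-1 *
  \int[mu]_(x in X)
    (dotU U x d * (expR (dotU U x (u - v)) * phi (v - x))).
Proof.
rewrite dotU_D_hat (p_mu_tilt u v); set k := expR _.
have -> : \int[mu]_(x in X) (dotU U x d * phi (u - x)) = k *
    \int[mu]_(x in X) (dotU U x d * (expR (dotU U x (u - v)) * phi (v - x))).
  rewrite -RintegralZl//.
    by apply: eq_Rintegral => x _; rewrite (phi_tilt u v) mulrCA.
  exact/continuous_integrable_cV/continuous_linear_formM/continuous_tilt.
by rewrite invfM mulrACA mulVf ?mul1r// gt_eqF ?expR_gt0.
Qed.

(** This is the difference of means treated by the tilting lemmas, with weight [phi (v - x)] and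
    exponent [dotU U x (u - v)]. *)
Lemma dotU_D_hat_sub u v d : dotU U (D u - D v) d =
  (\int[mu]_(x in X) (expR (dotU U x (u - v)) * phi (v - x)))^-1 *
  \int[mu]_(x in X)
    (dotU U x d * (expR (dotU U x (u - v)) * phi (v - x))) -
  (\int[mu]_(x in X) phi (v - x))^-1 *
  \int[mu]_(x in X) (dotU U x d * phi (v - x)).
Proof.
apply: etrans; first exact: dotUBl.
by congr (_ - _); [exact: dotU_D_hat_tilt|exact: dotU_D_hat].
Qed.

(** For [d = u - v] the averaged function is the tilting exponent itself. *)
Lemma D_hat_monotone u v : 0 <= dotU U (D u - D v) (u - v).
Proof.
rewrite dotU_D_hat_sub subr_ge0.
apply: tilted_mean_ge => //.
- by move=> x _; exact/ltW/phi_gt0.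
- exact/continuous_integrable_cV/continuous_phi.
- exact/continuous_integrable_cV/continuous_tilt.
- apply: continuous_Rintegral_gt0 => // [|x]; last exact: phi_gt0.
  exact: continuous_phi.
- apply: continuous_Rintegral_gt0 => // [|x].
    exact: continuous_tilt.
  by rewrite mulr_gt0// ?expR_gt0 ?phi_gt0.
- exact/continuous_integrable_cV/continuous_linear_formM/continuous_phi.
- exact/continuous_integrable_cV/continuous_linear_formM/continuous_tilt.
Qed.

(** The difference [d] is paired with itself. Cauchy-Schwarz bounds the exponent by
    [m * normU U (u - v)] and the averaged function by [m * normU U d]; one factor [normU U d] then
    cancels unless it is 0. *)
Lemma D_hat_lipschitz m u v : 0 <= m -> (forall x, X x -> normU U x <= m) ->
  normU U (D u - D v) <= m ^+ 2 * normU U (u - v).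
Proof.
move=> m0 hm; set d := D u - D v.
have bound h x : X x -> `|dotU U x h| <= m * normU U h.
  move=> Xx; apply: le_trans (normU_cauchy_schwarz psdU _ _) _.
  by rewrite ler_wpM2r ?sqrtr_ge0// hm.
have : dotU U d d <= (m * normU U (u - v)) * (m * normU U d).
  rewrite [X in X <= _]dotU_D_hat_sub.
  apply: tilted_mean_lip => //; rewrite ?mulr_ge0 ?sqrtr_ge0//.
  - by move=> x _; exact/ltW/phi_gt0.
  - exact/continuous_integrable_cV/continuous_phi.
  - exact/continuous_integrable_cV/continuous_tilt.
  - apply: continuous_Rintegral_gt0 => // [|x]; last exact: phi_gt0.
    exact: continuous_phi.
  - apply: continuous_Rintegral_gt0 => // [|x].
      exact: continuous_tilt.
    by rewrite mulr_gt0// ?expR_gt0 ?phi_gt0.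
  - by move=> x; exact: bound.
  - by move=> x; exact: bound.
  - exact/continuous_integrable_cV/continuous_linear_formM/continuous_phi.
  - exact/continuous_integrable_cV/continuous_linear_formM/continuous_tilt.
rewrite -sqr_normU// expr2 mulrACA -expr2 mulrA.
have [->|d0] := eqVneq (normU U d) 0.
  by rewrite mulr_ge0 ?sqrtr_ge0 ?sqr_ge0.
by rewrite ler_pM2r// lt_neqAle eq_sym d0 sqrtr_ge0.
Qed.

Lemma ln_p_muE z : ln (p z) = - 2^-1 * dotU U z z +
  ln (\int[mu]_(x in X) expR (dotU U x z - 2^-1 * dotU U x x)).
Proof.
have c : continuous
    (fun x : 'cV[R]_n => expR (dotU U x z - 2^-1 * dotU U x x)).
  move=> x; apply: continuous_comp; last exact: continuous_expR.
  apply: continuousB; first exact: continuous_linear_form.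
  apply: continuousM; first exact: cst_continuous.
  by apply: continuous_dotU => i; exact: coord_continuous.
rewrite -[X in X + _]expRK -lnM ?posrE ?expR_gt0//; last first.
  by apply: continuous_Rintegral_gt0 => // x; exact: expR_gt0.
congr ln; rewrite -RintegralZl//; last exact: continuous_integrable_cV.
by apply: eq_Rintegral => x _; rewrite phi_subr.
Qed.

(* [ln p] plus half the [U]-form is a log-Laplace transform, hence convex, and
   what is added beyond that is half of a positive semidefinite form. *)
Lemma ln_p_mu_weakly_convex rho (V : set 'cV[R]_n) :
  (forall x, dotU U x x <= rho * dotv x x) ->
  weakly_convex_on V rho (fun z => ln (p z)).
Proof.
move=> hrho t x y _ _.
pose k := t%:num; pose z := k *: x + (1 - k) *: y.
change (ln (p z) + rho / 2 * enorm z ^+ 2 <=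
  k * (ln (p x) + rho / 2 * enorm x ^+ 2) +
  (1 - k) * (ln (p y) + rho / 2 * enorm y ^+ 2)).
have k0 : 0 <= t%:num by [].
have k1 : t%:num <= 1 by [].
pose L z := \int[mu]_(x in X) expR (dotU U x z - 2^-1 * dotU U x x).
have c z' : continuous
    (fun x : 'cV[R]_n => expR (dotU U x z' - 2^-1 * dotU U x x)).
  move=> x'; apply: continuous_comp; last exact: continuous_expR.
  apply: continuousB; first exact: continuous_linear_form.
  apply: continuousM; first exact: cst_continuous.
  by apply: continuous_dotU => i; exact: coord_continuous.
have L0 z' : 0 < L z'.
  by apply: continuous_Rintegral_gt0 => // x'; exact: expR_gt0.
(* The exponent is affine in [z]: its quadratic term involves [x'] only, and the weights add up to
   1. *)
have zE x' : dotU U x' z - 2^-1 * dotU U x' x' =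
    k * (dotU U x' x - 2^-1 * dotU U x' x') +
    (1 - k) * (dotU U x' y - 2^-1 * dotU U x' x').
  by rewrite dotUDr !dotUZr; ring.
have LE : L z = \int[mu]_(x' in X)
    expR (k * (dotU U x' x - 2^-1 * dotU U x' x') +
    (1 - k) * (dotU U x' y - 2^-1 * dotU U x' x')).
  by apply: eq_Rintegral => x' _; rewrite zE.
have cvxL : ln (L z) <= k * ln (L x) + (1 - k) * ln (L y).
  rewrite LE; apply: ln_Rintegral_expR_convex => //.
  - exact/continuous_integrable_cV/c.
  - exact/continuous_integrable_cV/c.
  - under eq_fun do rewrite -zE; exact/continuous_integrable_cV/c.
  - exact: L0.
  - exact: L0.
  - by rewrite -LE; exact: L0.
(* [W] collects the added quadratic term and the concave term of ln p_mu; by [hrho] its form is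
   semidefinite, hence convex. *)
pose W := rho%:M - U.
have formE x' : dotU W x' x' = rho * enorm x' ^+ 2 - dotU U x' x'.
  rewrite sqr_sqrtr ?dotvv_ge0// /dotU mulmxBl mul_scalar_mx /dotv mulmxBr.
  by rewrite -scalemxAr mxE [in X in _ + X]mxE mxE.
have psdW : symmetric_psd W.
  split; first by rewrite linearB /= tr_scalar_mx psdU.1.
  move=> x'; rewrite -/(dotU W x' x') formE subr_ge0 sqr_sqrtr//.
  exact: dotvv_ge0.
have pE w : ln (p w) = - 2^-1 * dotU U w w + ln (L w) := ln_p_muE w.
have cvxW := dotU_convex psdW x y k0 k1.
rewrite -/k -/z formE (formE x) (formE y) in cvxW.
exact: le_conv_sub_half (pE x) (pE y) (pE z) cvxL cvxW.
Qed.

End denoiser_properties.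

(** * The form [U] built from [Sigma] *)

Section covariance.
Context (R : realType) (n r : nat).
Variables (Sigma : 'M[R]_n) (Pi : 'M[R]_(n, r)).
Hypotheses (hSigma : symmetric_psd Sigma)
  (hPi : orthonormal_basis_cols Pi (ran Sigma)).

Local Notation S := (Sigma_tilde Sigma Pi).

Lemma Sigma_tilde_sym : S^T = S.
Proof. by rewrite /Sigma_tilde !trmx_mul trmxK hSigma.1 mulmxA. Qed.

Lemma dotU_congr m (A : 'M[R]_m) (P : 'M[R]_(m, n)) x z :
  dotU (P^T *m A *m P) x z = dotU A (P *m x) (P *m z).
Proof. by rewrite /dotU /dotv trmx_mul !mulmxA. Qed.

(** A zero of the form puts [Pi *m x] in both the kernel and the range of the symmetric [Sigma],
    which are orthogonal. So [Pi *m x] vanishes, and [x] with it, as [Pi] preserves norms. *)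
Lemma Sigma_tilde_posdef x : x != 0 -> 0 < dotU S x x.
Proof.
move=> x0; have SE : dotU S x x = dotU Sigma (Pi *m x) (Pi *m x).
  by rewrite /dotU /dotv /Sigma_tilde trmx_mul !mulmxA.
rewrite SE lt_neqAle; apply/andP; split; last exact: hSigma.2.
apply: contraNneq x0 => /esym/(psd_kernel hSigma) SPx.
have [w _ wE] : ran Sigma (Pi *m x) by rewrite -hPi.2; exists x.
have : dotv (Pi *m x) (Pi *m x) = 0.
  rewrite -{2}wE -/(dotU Sigma _ _) (dotUC _ _ hSigma.1).
  by rewrite /dotU SPx /dotv mulmx0 mxE.
rewrite /dotv trmx_mul mulmxA -[_ *m _ *m Pi]mulmxA hPi.1 mulmx1 => h.
by rewrite -dotvv_eq0 /dotv h.
Qed.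

(** [Pi *m Pi^T] is an orthogonal projection; the inequality expands the squared norm of its
    residual at [x]. *)
Lemma dotv_trmx_le x : dotv (Pi^T *m x) (Pi^T *m x) <= dotv x x.
Proof.
have := dotvv_ge0 (x - Pi *m (Pi^T *m x)).
rewrite -!dotU1 (dotU_subr (psd1 R n)).
have -> : dotU 1%:M (Pi *m (Pi^T *m x)) x = dotU 1%:M (Pi^T *m x) (Pi^T *m x).
  by rewrite /dotU /dotv !mul1mx !trmx_mul !mulmxA.
have -> : dotU 1%:M (Pi *m (Pi^T *m x)) (Pi *m (Pi^T *m x)) =
    dotU 1%:M (Pi^T *m x) (Pi^T *m x).
  rewrite /dotU /dotv !mul1mx trmx_mul !mulmxA -[_ *m Pi^T *m Pi]mulmxA hPi.1.
  by rewrite mulmx1 -!mulmxA.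
by lra.
Qed.

Lemma dotU_covariance_le x :
  dotU (Pi *m invmx S *m Pi^T) x x <= (lambda_min S)^-1 * dotv x x.
Proof.
(* Reading [Pi] as the transpose of [Pi^T] turns the form at [x] into the inverse form at
   [Pi^T *m x]. *)
rewrite -[X in dotU (X *m _ *m _)]trmxK dotU_congr.
apply: (le_trans (dotU_invmx_le Sigma_tilde_sym Sigma_tilde_posdef _)).
apply: ler_wpM2l; last exact: dotv_trmx_le.
by rewrite invr_ge0; exact: lambda_min_ge0 Sigma_tilde_sym Sigma_tilde_posdef.
Qed.

Lemma covariance_psd : symmetric_psd (Pi *m invmx S *m Pi^T).
Proof.
have [sQ Q0] := invmx_psd Sigma_tilde_sym Sigma_tilde_posdef.
split; first by rewrite !trmx_mul trmxK sQ mulmxA.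
move=> x; rewrite -/(dotU _ x x) -[X in dotU (X *m _ *m _)]trmxK dotU_congr.
exact: Q0.
Qed.

End covariance.

Theorem proposition4p8 (R : realType) (n r : nat)
    (X : set 'cV[R]_n) (M : R)
    (Sigma : 'M[R]_n) (Pi : 'M[R]_(n, r))
    (mu : probability (borel_cV R n) R)
    (hX : compact X) (hM0 : 0 < M) (hM : forall x, X x -> enorm x <= M)
    (hSigma : symmetric_psd Sigma)
    (hr : r = \rank Sigma)
    (hPi : orthonormal_basis_cols Pi (ran Sigma))
    (hmu : mu X = 1%:E)
    (hsupp : conv_hull (supp mu) `<=` ran Sigma) :
  let V := ran Sigma in
  let lam := lambda_min (Sigma_tilde Sigma Pi) in
  let U := Pi *m invmx (Sigma_tilde Sigma Pi) *m Pi^T in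
  [/\ monotone_on V U (D_hat Sigma Pi X mu),
      lipschitz_U_on V U (M ^+ 2 / lam) (D_hat Sigma Pi X mu) &
      weakly_convex_on V lam^-1 (fun z => ln (p_mu Sigma Pi X mu z))].
Proof.
move=> V lam U.
have psdU := covariance_psd hSigma hPi.
have bdU := dotU_covariance_le hSigma hPi.
(* For [r = 0] both [lam] and [lam^-1] are 0, a case that the weak inequality includes. *)
have lam0 : 0 <= lam^-1.
  rewrite invr_ge0; apply: lambda_min_ge0; first exact: Sigma_tilde_sym.
  exact: Sigma_tilde_posdef.
split.
- by move=> u v _ _; exact: D_hat_monotone.
- move=> u v _ _.
  (* The radius [m] is [M] divided by the square root of [lam]: by [bdU] it bounds the [U]-norm on
     [X]. *)
  rewrite (_ : M ^+ 2 / lam = (M * Num.sqrt lam^-1) ^+ 2); last first.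
    by rewrite exprMn sqr_sqrtr.
  apply: D_hat_lipschitz => // [|x Xx].
    by rewrite mulr_ge0 ?sqrtr_ge0// ltW.
  apply: (@le_trans _ _ (Num.sqrt (lam^-1 * dotv x x))).
    by rewrite ler_wsqrtr// bdU.
  by rewrite sqrtrM// mulrC ler_wpM2r ?sqrtr_ge0//; exact: hM.
- by apply: ln_p_mu_weakly_convex => // x; exact: bdU.
Qed.
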